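(* Let $\mathcal{C}$ be a complete $d$-partite $d$-uniform clutter on $[n]$ with $d$-partition $\{V_i: i\in[d]\}$. For all $e\neq e'\in\mathcal{C}$ fix a vertex $v(e,e')\in e\setminus e'$ such that $v(e,e')$ and $v(e',e)$ lie in the same part of the partition. Let $e\in\mathcal{C}$, let $\phi_e: R[T_{e'} : e\neq e'\in\mathcal{C}]\to S_e$ be the surjective $R$-algebra homomorphism sending $T_{e'}$ to $\frac{\mathbf{x}_{e'}}{\mathbf{x}_e}$, and set $J_e=\ker\phi_e$. Then $J_e$ is generated by $G=G_1\cup G_2$, where $G_1$ is the set of all binomials of the form $x_i-x_rT_{e(i)}$ with $i\in[n]\setminus e$ and $r=v_e(i)$, and $G_2$ is the set of all binomials of the form $T_{e'}-T_{e(j')}T_{e'(j)}$ where $j=v(e,e')$ and $j'=v(e',e)$, for $e'\in\mathcal{C}$ with $|e'\setminus e|>1$.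
   Context: Let $k$ be an algebraically closed field, $R=k[x_1,\ldots,x_n]$, $[n]=\{1,\ldots,n\}$. A clutter $\mathcal{C}$ on $[n]$ is a family of subsets of $[n]$ (circuits), pairwise incomparable under inclusion; it is $d$-uniform if all circuits have cardinality $d$ ($d\geq1$). A $d$-uniform clutter is complete $d$-partite with $d$-partition $\{V_i: i\in[d]\}$ if $[n]$ is the union of the mutually disjoint sets $V_1,\ldots,V_d$, each circuit meets each $V_i$ in at most one vertex, and $\mathcal{C}$ contains all $d$-subsets of $[n]$ meeting each $V_i$ in at most one vertex. For $F\subseteq[n]$, $\mathbf{x}_F=\prod_{i\in F}x_i$, and $I(\mathcal{C})=(\mathbf{x}_F: F\in\mathcal{C})$. $S_e=k\big[\{x_1,\ldots,x_n\}\cup\{\mathbf{x}_{e'}/\mathbf{x}_e : e\neq e'\in\mathcal{C}\}\big]\subseteq k(x_1,\ldots,x_n)$ is the coordinate ring of the $e$-chart of the blowup of $\mathbb{A}^n_k$ along $I(\mathcal{C})$. For $e\in\mathcal{C}$ and $j\in[n]$, $v_e(j)$ is the unique vertex of $e$ in the same part of the partition as $j$, and $e(j)=(e\setminus\{v_e(j)\})\cup\{j\}\in\mathcal{C}$ is the circuit obtained from $e$ by replacing $v_e(j)$ by $j$. *)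

(* Defs.v *)
From HB Require Import structures.
From mathcomp Require Import all_boot all_order all_algebra.
From mathcomp Require Import boolp.
From mathcomp Require Import mpoly.
Set Implicit Arguments.
Unset Strict Implicit.
Unset Printing Implicit Defensive.
Import GRing.Theory.
Local Open Scope ring_scope.

Notation "x %:F" := (@tofrac _ x) : ring_scope.

(* The ideal of A generated by G: finite sums of multiples of elements of G. *)
Definition ideal_gen (A : comNzRingType) (G : A -> Prop) (p : A) : Prop :=
  exists2 s : seq (A * A),
    (forall q, q \in s -> G q.2) & p = \sum_(q <- s) q.1 * q.2.

Section Clutters.
Variable n : nat.
Implicit Types (C : {set {set 'I_n}}) (e f F : {set 'I_n}) (i j : 'I_n).

Definition is_clutter C : Prop :=
  forall F G, F \in C -> G \in C -> F \subset G -> F = G.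

Definition uniform d C : Prop := forall F, F \in C -> #|F| = d.

Definition complete_dpartite d C (V : 'I_d -> {set 'I_n}) : Prop :=
  [/\ \bigcup_(a < d) V a = setT,
      forall a b, a != b -> [disjoint V a & V b],
      forall F, F \in C -> forall a, (#|F :&: V a| <= 1)%N
    & forall F, #|F| = d -> (forall a, (#|F :&: V a| <= 1)%N) -> F \in C].

Definition same_part d (V : 'I_d -> {set 'I_n}) i j : bool :=
  [exists a, (i \in V a) && (j \in V a)].

(* v_e(j): the vertex of e in the part of j; the default j is never reached
   when e is a circuit of a complete d-partite d-uniform clutter. *)
Definition part_vertex d (V : 'I_d -> {set 'I_n}) e j : 'I_n :=
  odflt j [pick r in e | same_part V r j].

(* e(j): swap the vertex of e in the part of j for j. *)
Definition exchange d (V : 'I_d -> {set 'I_n}) e j : {set 'I_n} :=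
  j |: e :\ part_vertex V e j.

End Clutters.

Section Chart.
Variables (k : idomainType) (n : nat).
Variables (C : {set {set 'I_n}}) (e : {set 'I_n}).

Local Notation R := {mpoly k[n]}.
Local Notation K := {fraction {mpoly k[n]}}.

Definition xmon (F : {set 'I_n}) : R := \prod_(i in F) 'X_i.

Definition xratio (f : {set 'I_n}) : K := (xmon f)%:F / (xmon e)%:F.

(* z lies in every k-subalgebra of k(x_1, ..., x_n) that contains the x_i and
   the x_f / x_e with f in C, f != e. *)
Definition in_chart_ring (z : K) : Prop :=
  forall P : K -> Prop,
    (forall c : k, P (c%:MP)%:F) ->
    (forall a b, P a -> P b -> P (a - b)) ->
    (forall a b, P a -> P b -> P (a * b)) ->
    (forall i : 'I_n, P ('X_i)%:F) ->
    (forall f, f \in C -> f != e -> P (xratio f)) ->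
    P z.

Definition chart_pred : {pred K} := fun z => `[< in_chart_ring z >].

Fact chart_pred_subring : subring_closed chart_pred.
Proof.
split.
- apply/asboolP => P PC _ _ _ _.
  by have := PC 1; rewrite mpolyC1 tofrac1.
- move=> a b /asboolP Sa /asboolP Sb; apply/asboolP => P PC PB PM PX PT.
  by apply: (PB); [apply: Sa | apply: Sb].
- move=> a b /asboolP Sa /asboolP Sb; apply/asboolP => P PC PB PM PX PT.
  by apply: (PM); [apply: Sa | apply: Sb].
Qed.
HB.instance Definition _ :=
  GRing.isSubringClosed.Build K chart_pred chart_pred_subring.

(* The subring S_e = k[x_i, x_f / x_e] of k(x_1, ..., x_n), as a type. *)
Record chart_ring := ChartRing {
  chart_val :> K;
  chart_valP : chart_val \in chart_pred }.

HB.instance Definition _ := [isSub for chart_val].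
HB.instance Definition _ := [Choice of chart_ring by <:].
HB.instance Definition _ := [SubChoice_isSubComNzRing of chart_ring by <:].

Fact tofrac_chart (a : R) : a%:F \in chart_pred.
Proof.
apply/asboolP => P PC PB PM PX PT.
have P0 : P 0 by have := PC 0; rewrite mpolyC0 tofrac0.
have P1 : P 1 by have := PC 1; rewrite mpolyC1 tofrac1.
have PD x y : P x -> P y -> P (x + y).
  by move=> Px Py; rewrite -[y]opprK -[- y]sub0r; apply: (PB) => //; apply: PB.
rewrite [a]mpolyE raddf_sum /=; apply: (big_ind P) => // m _.
rewrite -mul_mpolyC tofracM; apply: (PM) => //.
rewrite mpolyXE_id rmorph_prod /=; apply: (big_ind P) => // i _.
by rewrite tofracXn; elim: (m i) => [|u IH] //; rewrite exprS; apply: PM.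
Qed.

(* The inclusion of R in S_e, which makes S_e an R-algebra. *)
Definition chart_incl (a : R) : chart_ring := ChartRing (tofrac_chart a).

Fact chart_incl_zmod : zmod_morphism chart_incl.
Proof. by move=> a b; apply: val_inj; rewrite /= rmorphB. Qed.
Fact chart_incl_monoid : monoid_morphism chart_incl.
Proof. by split=> [|a b]; apply: val_inj; rewrite /= ?rmorph1 ?rmorphM. Qed.
HB.instance Definition _ :=
  GRing.isZmodMorphism.Build R chart_ring chart_incl chart_incl_zmod.
HB.instance Definition _ :=
  GRing.isMonoidMorphism.Build R chart_ring chart_incl chart_incl_monoid.

Fact xratio_chart f : f \in C :\ e -> xratio f \in chart_pred.
Proof.
rewrite 2!inE => /andP[fe fC]; apply/asboolP => P _ _ _ _; exact.
Qed.

(* R[T_f : f in C, f != e]; the variables are numbered by the enumeration of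
   C :\ e. *)
Local Notation chart_poly := {mpoly R[#|C :\ e|]}.

Definition chart_X (i : 'I_n) : chart_poly := ('X_i : R)%:MP.

(* T_f; the value 0 is junk, for f not in C :\ e. *)
Definition chart_T (f : {set 'I_n}) : chart_poly :=
  if [pick t : 'I_#|C :\ e| | enum_val t == f] is Some t then 'X_t else 0.

(* The R-algebra map R[T_f] -> S_e sending T_f to x_f / x_e; see chart_mapC,
   chart_mapT and chart_map_surj below. *)
Definition chart_map (p : chart_poly) : chart_ring :=
  mmap chart_incl (fun t => ChartRing (xratio_chart (enum_valP t))) p.

Fact chart_map_zmod : zmod_morphism chart_map.
Proof. exact: rmorphB. Qed.
Fact chart_map_monoid : monoid_morphism chart_map.
Proof. by split; [exact: rmorph1 | exact: rmorphM]. Qed.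
HB.instance Definition _ :=
  GRing.isZmodMorphism.Build chart_poly chart_ring chart_map chart_map_zmod.
HB.instance Definition _ :=
  GRing.isMonoidMorphism.Build chart_poly chart_ring chart_map chart_map_monoid.

Lemma chart_mapC (a : R) : chart_map a%:MP = chart_incl a.
Proof. exact: mmapC. Qed.

Lemma chart_mapT f :
  f \in C -> f != e -> chart_map (chart_T f) = xratio f :> K.
Proof.
move=> fC fe; have fCe : f \in C :\ e by rewrite !inE fe.
rewrite /chart_T; case: pickP => [t /eqP <-|/(_ (enum_rank_in fCe f))].
  by rewrite /chart_map mmapX mmap1U.
by rewrite enum_rankK_in ?eqxx.
Qed.

Lemma chart_map_surj (z : chart_ring) : exists p, chart_map p = z.
Proof.
have /asboolP/(_ (fun y => exists p, chart_map p = y :> K)) := chart_valP z.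
case=> [c|_ _ [p <-] [q <-]|_ _ [p <-] [q <-]|i|f fC fe|p /val_inj <-].
- by exists (c%:MP)%:MP; rewrite chart_mapC.
- by exists (p - q); rewrite rmorphB.
- by exists (p * q); rewrite rmorphM.
- by exists (chart_X i); rewrite chart_mapC.
- by exists (chart_T f); rewrite chart_mapT.
- by exists p.
Qed.

End Chart.

Section Generators.
Variables (k : idomainType) (n d : nat) (C : {set {set 'I_n}}).
Variables (V : 'I_d -> {set 'I_n}) (v : {set 'I_n} -> {set 'I_n} -> 'I_n).
Variable e : {set 'I_n}.

Local Notation chart_poly := {mpoly {mpoly k[n]}[#|C :\ e|]}.
Local Notation X := (chart_X k C e).
Local Notation T := (chart_T k C e).

Definition G1 (p : chart_poly) : Prop :=
  exists2 i : 'I_n, i \notin e &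
    p = X i - X (part_vertex V e i) * T (exchange V e i).

Definition G2 (p : chart_poly) : Prop :=
  exists2 f : {set 'I_n}, f \in C /\ (1 < #|f :\: e|)%N &
    p = T f - T (exchange V e (v f e)) * T (exchange V f (v e f)).

End Generators.

Arguments chart_map {k n} C e p.
Arguments G1 {k n d} C V e p.
Arguments G2 {k n d} C V v e p.

(* Main.v *)
(* Modulo G, the relations in G_2 rewrite each T_f as the product of the T_{e(i)}
   over i in f \ e, and those in G_1 eliminate x_i for i outside e.  Hence
   R[T_f] / (G) is generated over k by n elements: the x_r with r in e and the
   T_{e(i)} with i outside e.  Their images x_r and x_i / x_{v_e(i)} in S_e are
   algebraically independent; this is seen by clearing denominators with a power
   of x_e, because x_f / x_e becomes the product of the variables T_{e(i)}. *)
Require Import Defs.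
From HB Require Import structures.
From mathcomp Require Import all_boot all_order all_algebra.
From mathcomp Require Import mpoly ring.
Set Implicit Arguments.
Unset Strict Implicit.
Unset Printing Implicit Defensive.
Import GRing.Theory.
Local Open Scope ring_scope.

(** * Congruence modulo a generated ideal *)

Section IdealGen.
Variables (A : comNzRingType) (G : A -> Prop).

Lemma ideal_gen0 : ideal_gen G 0.
Proof. by exists [::]; rewrite ?big_nil. Qed.

Lemma ideal_gen_base g : G g -> ideal_gen G g.
Proof.
move=> Gg; exists [:: (1, g)]; last by rewrite big_seq1 mul1r.
by move=> q; rewrite inE => /eqP ->.
Qed.

Lemma ideal_genD a b : ideal_gen G a -> ideal_gen G b -> ideal_gen G (a + b).
Proof.
move=> [s Gs ->] [t Gt ->]; exists (s ++ t); last by rewrite big_cat.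
by move=> q; rewrite mem_cat => /orP[/Gs|/Gt].
Qed.

Lemma ideal_genMl a b : ideal_gen G b -> ideal_gen G (a * b).
Proof.
move=> [s Gs ->]; exists [seq (a * q.1, q.2) | q <- s].
  by move=> _ /mapP[q /Gs Gq ->].
by rewrite big_map mulr_sumr; apply: eq_bigr => q _; rewrite mulrA.
Qed.

(** This and the next two lemmas make membership of a difference a congruence compatible with sums
    and products, so that congruence of two ring morphisms can be checked on generators. *)
Lemma ideal_genB_trans b a c :
  ideal_gen G (a - b) -> ideal_gen G (b - c) -> ideal_gen G (a - c).
Proof. by move=> Iab Ibc; rewrite -(subrKA b); apply: ideal_genD. Qed.

Lemma ideal_genB_add a b a' b' :
  ideal_gen G (a - a') -> ideal_gen G (b - b') ->
  ideal_gen G (a + b - (a' + b')).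
Proof. by move=> Ia Ib; rewrite opprD addrACA; apply: ideal_genD. Qed.

Lemma ideal_genB_mul a b a' b' :
  ideal_gen G (a - a') -> ideal_gen G (b - b') ->
  ideal_gen G (a * b - a' * b').
Proof.
move=> Ia Ib; apply: (@ideal_genB_trans (a * b')).
  by rewrite -mulrBr; apply: ideal_genMl.
by rewrite -mulrBl mulrC; apply: ideal_genMl.
Qed.

Lemma ideal_gen_kernel (B : nzRingType) (h : {rmorphism A -> B}) p :
  (forall g, G g -> h g = 0) -> ideal_gen G p -> h p = 0.
Proof.
move=> hG [s Gs ->]; rewrite rmorph_sum big_seq big1 // => q /Gs /hG hq.
by rewrite rmorphM hq mulr0.
Qed.

End IdealGen.

Lemma mpoly_ring_ind (A : comNzRingType) (n : nat) (P : {mpoly A[n]} -> Prop) :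
  (forall c, P c%:MP) -> (forall i, P 'X_i) ->
  (forall a b, P a -> P b -> P (a + b)) ->
  (forall a b, P a -> P b -> P (a * b)) -> forall p, P p.
Proof.
move=> PC PX PD PM p.
have P0 : P 0 by rewrite -mpolyC0.
have P1 : P 1 by rewrite -mpolyC1.
rewrite [p]mpolyE; apply: (big_ind P) => // m _.
rewrite -mul_mpolyC; apply: (PM) => //.
rewrite mpolyXE_id; apply: (big_ind P) => // i _.
by elim: (m i) => [|u IH] //; rewrite exprS; apply: PM.
Qed.

Lemma mpolyX_neq0 (A : nzRingType) (n : nat) (m : 'X_{1..n}) :
  'X_[m] != 0 :> {mpoly A[n]}.
Proof. by rewrite -msupp_eq0 msuppX. Qed.

(** * Exchanging vertices in complete d-partite clutters *)

Section Exchange.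
Variables (n d : nat) (C : {set {set 'I_n}}) (V : 'I_d -> {set 'I_n}).
Hypothesis uniformC : uniform d C.
Hypothesis completeC : complete_dpartite C V.

Lemma same_part_sym i j : same_part V i j = same_part V j i.
Proof. by apply: eq_existsb => a; rewrite andbC. Qed.

Lemma same_part_uniq a i j : i \in V a -> same_part V j i = (j \in V a).
Proof.
case: completeC => _ disjV _ _ ia; apply/existsP/idP => [[b /andP[jb ib]]|ja].
  have [<- //|/disjV] := eqVneq b a.
  by move=> /disjoint_setI0/setP/(_ i); rewrite !inE ib ia.
by exists a; rewrite ja.
Qed.

Lemma in_part i : exists a, i \in V a.
Proof.
case: completeC => covV _ _ _.
have : i \in \bigcup_(a < d) V a by rewrite covV inE.
by move=> /bigcupP[a _ ia]; exists a.
Qed.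

Lemma circuit_part_inj f i j :
  f \in C -> i \in f -> j \in f -> same_part V i j -> i = j.
Proof.
case: completeC => _ _ leV _ fC fi fj /existsP[a /andP[ia ja]].
by apply: (card_le1_eqP (leV f fC a)); rewrite inE ?fi ?fj.
Qed.

(** Pigeonhole: the [d] parts cut [f] into [d] pieces of size at most 1 whose sizes add up to [d],
    so no piece is empty. *)
Lemma circuit_meets_part f a : f \in C -> exists2 r, r \in f & r \in V a.
Proof.
case: completeC => covV disjV leV _ fC.
have cardf : (\sum_(b < d) #|f :&: V b|)%N = d.
  transitivity (\sum_(b < d) \sum_(i in f :&: V b) 1)%N.
    by apply: eq_bigr => b _; rewrite sum1_card.
  rewrite -[RHS](uniformC fC) -sum1_card.
  rewrite (exchange_big_dep (mem f)) /=; last by move=> b i _ /setIP[].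
  apply: eq_bigr => i fi; have [b ib] := in_part i.
  rewrite (big_pred1 b) // => c; rewrite inE fi /=.
  have [-> //|/disjV] := eqVneq c b.
  by move=> /disjoint_setI0/setP/(_ i); rewrite !inE ib andbT.
have /card_gt0P[r] : (0 < #|f :&: V a|)%N.
  rewrite lt0n; apply/negP => /eqP fa0.
  have : (\sum_(b < d | b != a) #|f :&: V b| <= \sum_(b in predC1 a) 1)%N.
    by apply: leq_sum => b _; apply: leV.
  rewrite sum1_card cardC1 card_ord.
  move: cardf; rewrite (bigD1 a) //= fa0 add0n => ->.
  (* What is left, [d <= d.-1], fails because the index [a] forces [0 < d]. *)
  by rewrite leqNgt ltn_predL (leq_ltn_trans _ (ltn_ord a)).
by rewrite inE => /andP[]; exists r.
Qed.

Lemma part_vertexP f i :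
  f \in C -> part_vertex V f i \in f /\ same_part V (part_vertex V f i) i.
Proof.
move=> fC; rewrite /part_vertex; case: pickP => [r /andP[] //|no].
have [a ia] := in_part i; have [r fr ra] := circuit_meets_part a fC.
by have := no r; rewrite (same_part_uniq _ ia) /= fr ra.
Qed.

Lemma part_vertex_eq f i r :
  f \in C -> r \in f -> same_part V r i -> part_vertex V f i = r.
Proof.
move=> fC fr ri; have [fp pi] := part_vertexP i fC.
apply: (circuit_part_inj fC fp fr).
have [a ia] := in_part i; move: ri pi; rewrite !(same_part_uniq _ ia) => ra pa.
by apply/existsP; exists a; rewrite pa.
Qed.

Lemma part_vertex_id f i : f \in C -> i \in f -> part_vertex V f i = i.
Proof.
move=> fC fi; apply: part_vertex_eq => //.
by have [a ia] := in_part i; rewrite (same_part_uniq _ ia).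
Qed.

Lemma part_vertex_imset e f :
  e \in C -> f \in C -> [set part_vertex V e i | i in f] = e.
Proof.
move=> eC fC; apply/setP => r; apply/imsetP/idP => [[i _ ->]|er].
  by have [] := part_vertexP i eC.
have [fp pr] := part_vertexP r fC; exists (part_vertex V f r) => //.
by rewrite (part_vertex_eq eC er) // same_part_sym.
Qed.

(** The image of [f] is all of [e], and both sets have [d] elements. *)
Lemma part_vertex_inj e f :
  e \in C -> f \in C -> {in f &, injective (part_vertex V e)}.
Proof.
move=> eC fC; apply/imset_injP.
by rewrite part_vertex_imset // (uniformC eC) (uniformC fC).
Qed.

Lemma exchange_in f i : f \in C -> exchange V f i \in C.
Proof.
move=> fC; have [fp pi] := part_vertexP i fC.
rewrite /exchange; have [fi|nfi] := boolP (i \in f).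
  by rewrite part_vertex_id // setD1K.
case: completeC => _ _ _; apply.
  rewrite cardsU1 !inE (negPf nfi) andbF add1n.
  by have := cardsD1 (part_vertex V f i) f; rewrite fp add1n (uniformC fC).
(* Two vertices in one part can only be [i] and an old vertex of its part; [old] excludes this, as
   that vertex is the one removed. *)
move=> a; apply/card_le1_eqP => x y; rewrite !inE.
have old z : i \in V a -> z != part_vertex V f i -> z \in f -> z \in V a -> False.
  move=> ia /eqP nz fz za; apply: nz; apply/esym/part_vertex_eq => //.
  by rewrite (same_part_uniq _ ia).
move=> /andP[/orP[/eqP ->|/andP[xp fx]] xa] /andP[/orP[/eqP ->|/andP[yp fy]] ya] //.
- by case: (old y).
- by case: (old x).
- apply: (circuit_part_inj fC) => //.
  by apply/existsP; exists a; rewrite ya.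
Qed.

Lemma exchange_neq e i : e \in C -> i \notin e -> exchange V e i != e.
Proof. by move=> eC; apply: contraNneq => <-; rewrite !inE eqxx. Qed.

(** Division-free form, inside R, of x_{f(i)} / x_f = x_i / x_{v_f(i)}. *)
Lemma xmon_exchange (k : idomainType) f i : f \in C ->
  xmon k (exchange V f i) * 'X_(part_vertex V f i) = xmon k f * 'X_i.
Proof.
move=> fC; have [fp pi] := part_vertexP i fC.
rewrite /exchange; have [fi|nfi] := boolP (i \in f).
  by rewrite part_vertex_id // setD1K.
rewrite /xmon big_setU1 ?inE ?(negPf nfi) ?andbF //=.
by rewrite [in RHS](big_setD1 _ fp) /= mulrAC [RHS]mulrC mulrA.
Qed.

End Exchange.

(** * The chart algebra and the fixed pairs of vertices *)

Section ChartKernel.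
Variables (k : idomainType) (n d : nat) (C : {set {set 'I_n}}).
Variables (V : 'I_d -> {set 'I_n}) (v : {set 'I_n} -> {set 'I_n} -> 'I_n).
Variable e : {set 'I_n}.
Hypothesis uniformC : uniform d C.
Hypothesis completeC : complete_dpartite C V.
Hypothesis v_diff :
  forall f g, f \in C -> g \in C -> f != g -> v f g \in f :\: g.
Hypothesis v_part :
  forall f g, f \in C -> g \in C -> f != g -> same_part V (v f g) (v g f).
Hypothesis eC : e \in C.

Local Notation R := {mpoly k[n]}.
Local Notation chart_poly := {mpoly R[#|C :\ e|]}.
Local Notation K := {fraction R}.
Local Notation s := (part_vertex V e).
Local Notation T := (chart_T k C e).
Local Notation X := (chart_X k C e).
Local Notation I := (ideal_gen (fun q : chart_poly => G1 C V e q \/ G2 C V v e q)).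

Lemma chart_T_enum_val t : T (enum_val t) = 'X_t.
Proof.
rewrite /chart_T; case: pickP => [u /eqP/enum_val_inj -> //|/(_ t)].
by rewrite eqxx.
Qed.

Lemma chart_poly_ind (P : chart_poly -> Prop) :
  (forall c : k, P (c%:MP)%:MP) -> (forall i, P (X i)) ->
  (forall f, f \in C -> f != e -> P (T f)) ->
  (forall a b, P a -> P b -> P (a + b)) ->
  (forall a b, P a -> P b -> P (a * b)) -> forall p, P p.
Proof.
move=> PC PX PT PD PM; apply: mpoly_ring_ind => // [c|t].
  move: c; apply: mpoly_ring_ind => // a b Pa Pb.
    by rewrite mpolyCD; apply: PD.
  by rewrite mpolyCM; apply: PM.
rewrite -chart_T_enum_val; have := enum_valP t.
by rewrite !inE => /andP[fe fC]; apply: PT.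
Qed.

Lemma v_neq f : f \in C -> f != e ->
  [/\ v e f \in e, v e f \notin f, v f e \in f & v f e \notin e].
Proof.
move=> fC fe; have := v_diff fC eC fe.
have := v_diff eC fC; rewrite eq_sym => /(_ fe).
by rewrite !inE => /andP[-> ->] /andP[-> ->].
Qed.

Lemma v_vertex f : f \in C -> f != e ->
  s (v f e) = v e f /\ part_vertex V f (v e f) = v f e.
Proof.
move=> fC fe; have [ve _ vf _] := v_neq fC fe.
have vv := v_part fC eC fe.
split; apply: (part_vertex_eq uniformC completeC) => //.
by rewrite same_part_sym.
Qed.

Lemma cardD_neq f : (1 < #|f :\: e|)%N -> f != e.
Proof. by apply: contraTneq => ->; rewrite setDv cards0. Qed.

(** The exchange trades [v f e], outside [e], for [v e f], inside [e]. This count is the measure for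
    the induction in [chart_T_reduce]. *)
Lemma cardD_exchange f : f \in C -> f != e ->
  #|f :\: e| = #|exchange V f (v e f) :\: e|.+1.
Proof.
move=> fC fe; have [ve nvf vf nve] := v_neq fC fe.
have [_ vv] := v_vertex fC fe.
rewrite (cardsD1 (v f e)) !inE vf nve add1n; congr _.+1.
apply: eq_card => x; rewrite /exchange vv !inE.
have [->|_] := eqVneq x (v e f); first by rewrite ve /= andbF.
by rewrite /= andbCA.
Qed.

(** * The generators vanish in S_e *)

Local Notation "'phi' p" := (@chart_val k n C e (chart_map C e p)) (at level 10, p at level 8).

Lemma phiB p q : phi (p - q) = phi p - phi q.
Proof. by rewrite rmorphB. Qed.

Lemma phiM p q : phi (p * q) = phi p * phi q.
Proof. by rewrite rmorphM. Qed.

Lemma phiX i : phi (X i) = ('X_i)%:F.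
Proof. by rewrite chart_mapC. Qed.

Lemma xmon_neq0 (f : {set 'I_n}) : xmon k f != 0.
Proof.
by apply/prodf_neq0 => i _; rewrite mpolyX_neq0.
Qed.

Lemma xmon_exchange_eq (f : {set 'I_n}) i : f \in C ->
  (xmon k (exchange V f i))%:F =
  (xmon k f)%:F * ('X_i)%:F / ('X_(part_vertex V f i))%:F :> K.
Proof.
move=> fC; rewrite -tofracM -(xmon_exchange uniformC completeC) // tofracM.
by rewrite mulfK // tofrac_eq0 mpolyX_neq0.
Qed.

(** This identity and the next are the images of the relations in G_1 and G_2, with [a] for x_e, [b]
    for x_f, [y] for the vertex entering [e] and [x] for the one leaving it. *)
Lemma swap_ratio1 (F : fieldType) (a x y : F) :
  a != 0 -> x != 0 -> y - x * (a * y / x / a) = 0.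
Proof. by move=> a0 x0; field; rewrite a0 x0. Qed.

Lemma swap_ratio2 (F : fieldType) (a b x y : F) :
  a != 0 -> x != 0 -> y != 0 -> b / a - a * y / x / a * (b * x / y / a) = 0.
Proof. by move=> a0 x0 y0; field; rewrite a0 x0 y0. Qed.

Lemma common_denominator (A : comNzRingType) (a b u : A) N M :
  (a + b) * u ^+ (N + M) = a * u ^+ N * u ^+ M + b * u ^+ M * u ^+ N.
Proof. by rewrite exprD; ring. Qed.

Lemma gens_in_kernel (q : chart_poly) :
  G1 C V e q \/ G2 C V v e q -> chart_map C e q = 0.
Proof.
have x0 i : ('X_i : R)%:F != 0 by rewrite tofrac_eq0 mpolyX_neq0.
have e0 : (xmon k e)%:F != 0 by rewrite tofrac_eq0 xmon_neq0.
case=> [[i ie ->]|[f [fC /[dup] lt1 /cardD_neq fe] ->]]; apply: val_inj => /=.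
  have iC := exchange_in uniformC completeC i eC.
  rewrite phiB phiM !phiX chart_mapT ?(exchange_neq V eC ie) //.
  rewrite /xratio xmon_exchange_eq //.
  exact: (swap_ratio1 _ e0 (x0 (s i))).
have [ve nvf vf nve] := v_neq fC fe; have [sv sf] := v_vertex fC fe.
(* The bound |f \ e| > 1 ensures that the last variable in the relation is a genuine T, not the junk
   value 0. *)
have e2 : exchange V f (v e f) != e.
  by apply: contraTneq lt1 => E; rewrite (cardD_exchange fC fe) E setDv cards0.
have veC := exchange_in uniformC completeC (v f e) eC.
have vfC := exchange_in uniformC completeC (v e f) fC.
rewrite phiB phiM !chart_mapT ?(exchange_neq V eC nve) //.
rewrite /xratio !xmon_exchange_eq // sv sf.
exact: (swap_ratio2 _ e0 (x0 _) (x0 _)).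
Qed.

(** * Reduction to n variables, and its kernel *)

(* In the target of [reduce], the variable ['X_i] stands for x_i when i is in e
   and for T_{e(i)} otherwise. *)
Definition slope (i : 'I_n) : R := if i \in e then 1 else 'X_i.

(** The relations in G_1 read as a substitution: x_i becomes x_{v_e(i)} T_{e(i)}, and stays x_i when
    i is in e. *)
Definition reduceR : R -> R :=
  mmap (@mpolyC n k) (fun i => 'X_(s i) * slope i).

HB.instance Definition _ := GRing.RMorphism.on reduceR.

Definition reduce : chart_poly -> R :=
  mmap reduceR (fun t : 'I_#|C :\ e| =>
    \prod_(i in (enum_val t : {set 'I_n})) slope i).

HB.instance Definition _ := GRing.RMorphism.on reduce.

Lemma reduceC a : reduce a%:MP = reduceR a.
Proof. exact: mmapC. Qed.

Lemma reduceR_X i : reduceR 'X_i = 'X_(s i) * slope i.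
Proof. by rewrite /reduceR mmapX mmap1U. Qed.

Lemma reduceX i : reduce (X i) = 'X_(s i) * slope i.
Proof. by rewrite reduceC reduceR_X. Qed.

Lemma reduceT f : f \in C -> f != e -> reduce (T f) = \prod_(i in f) slope i.
Proof.
move=> fC fe; have fCe : f \in C :\ e by rewrite !inE fe.
rewrite -(enum_rankK_in fCe fCe) chart_T_enum_val.
by rewrite /reduce mmapX mmap1U.
Qed.

(** The map v_e sends [f] bijectively onto [e], so the factors ['X_(s i)] multiply to x_e. *)
Lemma reduceR_xmon f : f \in C ->
  reduceR (xmon k f) = xmon k e * \prod_(i in f) slope i.
Proof.
move=> fC; rewrite rmorph_prod /= (eq_bigr _ (fun i _ => reduceR_X i)).
rewrite big_split /=; congr (_ * _).
rewrite -(big_imset (fun j => 'X_j)) /=.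
  by rewrite (part_vertex_imset uniformC completeC).
exact: (part_vertex_inj uniformC completeC eC fC).
Qed.

Lemma slope_prod_e : \prod_(i in e) slope i = 1.
Proof. by apply: big1 => i ie; rewrite /slope ie. Qed.

(** One numerator [Q] serves both maps: T_f becomes x_f after multiplication by x_e, and
    [reduceR_xmon] is the same identity after reduction. *)
Lemma clear_denominators p : exists N Q,
  phi p * ((xmon k e)%:F) ^+ N = Q%:F /\ reduce p * xmon k e ^+ N = reduceR Q.
Proof.
(* Since x_e is fixed, the two summands can be brought to a common power of x_e on both sides. *)
have Re : reduceR (xmon k e) = xmon k e.
  by rewrite reduceR_xmon // slope_prod_e mulr1.
move: p; apply: chart_poly_ind => [c|i|f fC fe|a b|a b].
- by exists 0, c%:MP; rewrite chart_mapC reduceC !mulr1.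
- by exists 0, 'X_i; rewrite phiX reduceX reduceR_X !mulr1.
- exists 1, (xmon k f); rewrite chart_mapT // reduceT // reduceR_xmon //.
  split; last exact: mulrC.
  by rewrite /xratio divfK // tofrac_eq0 xmon_neq0.
- move=> [N [Q [Ea Ra]]] [M [P [Eb Rb]]].
  exists (N + M), (Q * xmon k e ^+ M + P * xmon k e ^+ N).
  rewrite !rmorphD !rmorphM !rmorphXn /= Re -Ea -Ra -Eb -Rb.
  by split; apply: common_denominator.
- move=> [N [Q [Ea Ra]]] [M [P [Eb Rb]]]; exists (N + M), (Q * P).
  by rewrite !rmorphM /= -Ea -Ra -Eb -Rb !exprD; split; apply: mulrACA.
Qed.

(** The numerator [Q] vanishes, and the power of x_e cancels in the domain R. *)
Lemma reduce_kernel p : chart_map C e p = 0 -> reduce p = 0.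
Proof.
move=> p0; have [N [Q []]] := clear_denominators p.
rewrite p0 mul0r => /esym/eqP; rewrite tofrac_eq0 => /eqP ->.
rewrite rmorph0 => /eqP; rewrite mulf_eq0 expf_eq0 (negPf (xmon_neq0 e)).
by rewrite andbF orbF => /eqP.
Qed.

(** * Lifting back, and normal forms modulo the ideal *)

Definition chart_section_gen i : chart_poly :=
  if i \in e then X i else T (exchange V e i).

Definition chart_section : R -> chart_poly :=
  mmap ((@mpolyC _ _) \o (@mpolyC n k)) chart_section_gen.

HB.instance Definition _ := GRing.RMorphism.on chart_section.

Lemma chart_section_X i : chart_section 'X_i = chart_section_gen i.
Proof. by rewrite /chart_section mmapX mmap1U. Qed.

Lemma chart_sectionC c : chart_section c%:MP = (c%:MP)%:MP.
Proof. exact: mmapC. Qed.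

Lemma chart_section_slope i :
  chart_section (slope i) = if i \in e then 1 else T (exchange V e i).
Proof.
rewrite /slope; case: ifP => ie; first by rewrite rmorph1.
by rewrite chart_section_X /chart_section_gen ie.
Qed.

Lemma ideal_gen_refl a : I (a - a).
Proof. by rewrite subrr; apply: ideal_gen0. Qed.

Lemma slope_prod_exchange f j : f \in C -> j \in e -> j \notin f ->
  \prod_(i in f) slope i =
  slope (part_vertex V f j) * \prod_(i in exchange V f j) slope i.
Proof.
move=> fC je jf; have [fp _] := part_vertexP uniformC completeC j fC.
rewrite (big_setD1 _ fp) /= /exchange big_setU1 ?inE ?(negPf jf) ?andbF //=.
by rewrite {1}[slope j]/slope je mul1r.
Qed.

(** Induction on |f \ e|: a relation in G_2 splits off one factor T_{e(i)}, and the circuit left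
    over is one vertex closer to [e]. *)
Lemma chart_T_reduce f : f \in C -> f != e ->
  I (T f - chart_section (\prod_(i in f) slope i)).
Proof.
have [m] := ubnP #|f :\: e|; elim: m f => // m IH f ltm fC fe.
have [ve nvf vf nve] := v_neq fC fe; have [sv sf] := v_vertex fC fe.
rewrite (slope_prod_exchange fC ve nvf) sf rmorphM /= chart_section_slope (negPf nve).
have gC := exchange_in uniformC completeC (v e f) fC.
have cardf := cardD_exchange fC fe.
(* If the exchange gives [e] itself, then [f] is already some e(i) and no relation is called for. *)
have [ge|ge] := eqVneq (exchange V f (v e f)) e.
  suff -> : exchange V e (v f e) = f.
    by rewrite ge slope_prod_e rmorph1 mulr1; apply: ideal_gen_refl.
  rewrite /exchange sv -[X in X :\ _]ge /exchange sf setU1K ?setD1K //.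
  by rewrite !inE (negPf nvf) andbF.
apply: ideal_genB_trans (ideal_genB_mul (ideal_gen_refl _) (IH _ _ gC ge)).
  apply: ideal_gen_base; right; exists f => //; split=> //.
  (* Otherwise |f \ e| > 1: the exchanged circuit is not contained in [e], since both have [d]
     vertices and they differ. *)
  rewrite cardf ltnS card_gt0; apply: contra ge.
  rewrite setD_eq0 => sub; rewrite eqEcard sub.
  by rewrite (uniformC eC) (uniformC gC) /=.
by rewrite -ltnS -cardf.
Qed.

(** It suffices to compare two ring morphisms on generators: G_1 handles the x_i with i outside e,
    and [chart_T_reduce] the T_f. *)
Lemma chart_section_reduce p : I (p - chart_section (reduce p)).
Proof.
move: p; apply: chart_poly_ind => [c|i|f fC fe|a b Ia Ib|a b Ia Ib].
- rewrite reduceC /reduceR mmapC chart_sectionC; exact: ideal_gen_refl.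
- rewrite reduceX rmorphM /= chart_section_slope chart_section_X /chart_section_gen.
  have [-> _] := part_vertexP uniformC completeC i eC.
  case: ifPn => ie; last by apply: ideal_gen_base; left; exists i.
  rewrite (part_vertex_id uniformC completeC) // mulr1.
  exact: ideal_gen_refl.
- by rewrite reduceT //; apply: chart_T_reduce.
- by rewrite (rmorphD reduce) (rmorphD chart_section); exact: (ideal_genB_add Ia Ib).
- by rewrite (rmorphM reduce) (rmorphM chart_section); exact: (ideal_genB_mul Ia Ib).
Qed.

(** For [p] in the kernel [reduce p] is 0, so [p] is congruent to 0 by [chart_section_reduce]. *)
Lemma chart_kernel p : chart_map C e p = 0 <-> I p.
Proof.
split=> [/reduce_kernel p0|]; last exact/ideal_gen_kernel/gens_in_kernel.
by have := chart_section_reduce p; rewrite p0 rmorph0 subr0.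
Qed.

End ChartKernel.

Theorem proposition4p1 (k : closedFieldType) (n d : nat)
    (C : {set {set 'I_n}}) (V : 'I_d -> {set 'I_n})
    (v : {set 'I_n} -> {set 'I_n} -> 'I_n) (e : {set 'I_n})
    (d_gt0 : (0 < d)%N)
    (clutterC : is_clutter C)
    (uniformC : uniform d C)
    (completeC : complete_dpartite C V)
    (v_diff : forall f g, f \in C -> g \in C -> f != g -> v f g \in f :\: g)
    (v_part : forall f g, f \in C -> g \in C -> f != g ->
        same_part V (v f g) (v g f))
    (eC : e \in C) :
  forall p : {mpoly {mpoly k[n]}[#|C :\ e|]},
    chart_map C e p = 0 <->
    ideal_gen (fun q => G1 C V e q \/ G2 C V v e q) p.
Proof. by move=> p; apply: chart_kernel. Qed.
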